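(* Let $G=(V,E)$ be a 3-edge-connected graph with $m$ edges and $n$ vertices, and let $K$ be a field of characteristic $p$. Then $\mathcal{L}_K(\mathcal{C}(G))$ is a $K$-vector space of dimension \[ \dim_K \mathcal{L}_K(\mathcal{C}(G)) = \begin{cases} m, & p\neq 2,\\ m-n+1, & p=2.\end{cases} \] If $p\neq 2$, then the image of any $\mathbb{Z}$-basis of the cycle lattice $\mathcal{L}(\mathcal{C}(G))$ under the natural map $\mathbb{Z}^E\to K^E$ (reduction modulo $p$) is a linear basis of $\mathcal{L}_K(\mathcal{C}(G))$. If $p=2$, then any basis of the binary cycle space of $G$ maps to a linear basis of $\mathcal{L}_K(\mathcal{C}(G))$ under the natural inclusion $(\mathbb{Z}/2\mathbb{Z})^E\subseteq K^E$.
   Context: Graphs may have loops and parallel edges. A cycle of $G$ is a connected subgraph in which every vertex has degree two, regarded as a subset of $E$; $\mathcal{C}(G)$ is the set of cycles and $\chi_C\in\mathbb{Z}^E$ its characteristic vector. The cycle lattice is $\mathcal{L}(\mathcal{C}(G))=\{\sum_C n_C\chi_C : n_C\in\mathbb{Z}\}\subseteq\mathbb{Z}^E$. For a field $K$, $\mathcal{L}_K(\mathcal{C}(G))=\{\sum_C a_C\chi_C: a_C\in K\}\subseteq K^E$. The binary cycle space is the subspace of $(\mathbb{Z}/2\mathbb{Z})^E$ spanned by the characteristic vectors of cycles. A graph is 3-edge-connected if it is connected and remains connected after deleting any at most two edges. Characteristic $p$ may be $0$ (then $p\ne 2$). *)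

(* Defs.v *)
From HB Require Import structures.
From mathcomp Require Import all_boot all_order all_algebra.

Set Implicit Arguments.
Unset Strict Implicit.
Unset Printing Implicit Defensive.

Import GRing.Theory.
Local Open Scope ring_scope.

(* Finite graphs with loops and parallel edges.  The two ends of an edge are
   stored as an ordered pair, but every notion below is symmetric in them. *)
Record multigraph := Multigraph {
  vertex : finType;
  edge : finType;
  ends : edge -> vertex * vertex
}.

Section Graph.
Variable G : multigraph.
Implicit Types (W : {set vertex G}) (F C : {set edge G}).

(* A loop at v contributes 2. *)
Definition degree F (v : vertex G) : nat :=
  (\sum_(e in F) (((ends e).1 == v) + ((ends e).2 == v)))%N.

Definition is_subgraph W F : bool :=
  [forall e in F, ((ends e).1 \in W) && ((ends e).2 \in W)].

Definition adjacent F : rel (vertex G) :=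
  fun u v => [exists e in F, (ends e == (u, v)) || (ends e == (v, u))].

(* Meaningful when is_subgraph W F holds; the null graph is not connected. *)
Definition is_connected W F : bool :=
  (W != set0) && [forall u in W, forall v in W, connect (adjacent F) u v].

Definition is_cycle C : bool :=
  [exists W : {set vertex G},
    [&& is_subgraph W C, is_connected W C & [forall v in W, degree C v == 2%N]]].

Definition three_edge_connected : bool :=
  [forall F : {set edge G}, (#|F| <= 2)%N ==> is_connected [set: vertex G] (~: F)].

Definition chi (R : nzRingType) C : {ffun edge G -> R} :=
  [ffun e => (e \in C)%:R].

Definition cycle_vectors (R : nzRingType) : seq {ffun edge G -> R} :=
  [seq chi R C | C <- enum is_cycle].

Definition cycle_lattice (x : {ffun edge G -> int}) : Prop :=
  inIntSpan (in_tuple (cycle_vectors int)) x.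

(* K^o is K seen as a vector space over itself. *)
Definition cycle_space (K : fieldType) : {vspace {ffun edge G -> K^o}} :=
  <<(cycle_vectors K : seq {ffun edge G -> K^o})>>%VS.

Definition binary_cycle_space : {vspace {ffun edge G -> ('F_2)^o}} :=
  cycle_space 'F_2.

Definition reduce (K : fieldType) (x : {ffun edge G -> int}) :
    {ffun edge G -> K^o} :=
  [ffun e => (x e)%:~R : K].

(* Each entry goes through its representative 0 or 1 in nat; when K has
   characteristic 2 this is the unique ring morphism from 'F_2 to K. *)
Definition binary_incl (K : fieldType) (x : {ffun edge G -> ('F_2)^o}) :
    {ffun edge G -> K^o} :=
  [ffun e => (nat_of_ord (x e))%:R : K].

End Graph.

Definition is_Zbasis (V : zmodType) (L : V -> Prop) (b : seq V) : Prop :=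
  (forall x : V, L x <-> inIntSpan (in_tuple b) x) /\
  (forall a : 'I_(size b) -> int,
      \sum_(i < size b) b`_i *~ a i = 0 -> forall i, a i = 0).

(* [pchar K] only contains prime numbers. *)
Definition has_characteristic (K : fieldType) (p : nat) : Prop :=
  if p is 0%N then [pchar K] =i pred0 else p \in [pchar K].

(* Main.v *)
(* In characteristic 2 the cycle space is the kernel of the vertex-edge boundary
   map: an edge in the support of a kernel element lies on a cycle inside that
   support, so cycles can be subtracted until nothing is left.  Connectedness
   makes the image of the boundary map the hyperplane of coordinate sum 0, which
   gives the dimension m - n + 1 over K as well as over F_2.

   Otherwise, call a set of edges even if all its degrees are even; its
   characteristic vector is an integral sum of cycles.  By 3-edge-connectedness,
   for all edges e <> f some even set contains e but not f, so {e} is an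
   intersection of even sets, and 2^N chi_e lies in the cycle lattice for a
   uniform N.  Hence the cycles span K^E.  Writing a Z-basis as the rows of a
   matrix B, there is an integral A with A B = 2^N, and Z-independence gives
   B A = 2^N too, so the rows of B stay independent over K. *)
From HB Require Import structures.
Require Import Defs.
From mathcomp Require Import all_boot all_order all_algebra.
From mathcomp Require Import zify.
Import GRing.Theory.
Local Open Scope ring_scope.

Set Implicit Arguments.
Unset Strict Implicit.

(** * Degrees modulo 2, paths and cycles *)

Section Graph.
Variable G : multigraph.
Implicit Types (F C P S : {set edge G}) (e f : edge G) (u v w : vertex G).

Definition incidence e v : nat := (((ends e).1 == v) + ((ends e).2 == v))%N.

Lemma degreeE F v : degree F v = (\sum_e (e \in F) * incidence e v)%N.
Proof.
rewrite /degree big_mkcond; apply: eq_bigr => e _.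
by case: (e \in F); rewrite ?mul1n ?mul0n.
Qed.

Lemma degreeU1 F f v :
  f \notin F -> degree (f |: F) v = (incidence f v + degree F v)%N.
Proof. by move=> nFf; rewrite /degree big_setU1. Qed.

Lemma degree_end F f v : f \in F -> (0 < incidence f v)%N -> (0 < degree F v)%N.
Proof. by move=> Ff; rewrite /degree (big_setD1 f Ff) /= addn_gt0 => ->. Qed.

Definition symdiff F P : {set edge G} := (F :\: P) :|: (P :\: F).

Lemma in_symdiff F P e : (e \in symdiff F P) = (e \in F) (+) (e \in P).
Proof. by rewrite !inE; do 2!case: (e \in _). Qed.

Lemma odd_degree_symdiff F P v :
  odd (degree (symdiff F P) v) = odd (degree F v) (+) odd (degree P v).
Proof.
rewrite -oddD !degreeE -big_split /=.
elim/big_rec2: _ => // e x y _ eq_xy; rewrite oddD eq_xy oddD in_symdiff.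
case: (e \in F); case: (e \in P); rewrite ?mul1n ?mul0n //= ?addn0 //.
by rewrite addnn odd_double.
Qed.

Lemma adjacentS F P : F \subset P -> subrel (adjacent F) (adjacent P).
Proof.
move=> /subsetP sFP u v /existsP[e /andP[Fe uv]].
by apply/existsP; exists e; rewrite sFP.
Qed.

Lemma adjacent_sym F : symmetric (adjacent F).
Proof. by move=> u v; apply: eq_existsb => e; rewrite orbC. Qed.

Lemma adjacent_ends F e : e \in F -> adjacent F (ends e).1 (ends e).2.
Proof.
by move=> Fe; apply/existsP; exists e; rewrite Fe -surjective_pairing eqxx.
Qed.

Lemma adjacent_incidence F u w : adjacent F u w ->
  exists e, [/\ e \in F, adjacent [set e] u w
    & forall v, incidence e v = ((v == u) + (v == w))%N].
Proof.
case/existsP=> e /andP[Fe uw]; exists e; split=> // [|v].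
  by apply/existsP; exists e; rewrite set11.
rewrite /incidence; case/orP: uw => /eqP-> /=; rewrite 2?(eq_sym v) //.
by rewrite addnC.
Qed.

(** Take the symmetric difference of the edges along a walk: at each inner vertex the contributions
    cancel modulo 2, even if the walk repeats edges. *)
Lemma connected_odd_set F u w : connect (adjacent F) u w ->
  exists2 P : {set edge G}, P \subset F & forall v, odd (degree P v) = (v == u) (+) (v == w).
Proof.
case/connectP=> p; elim: p u => [|u' p IHp] u /=.
  move=> _ ->; exists set0; first exact: sub0set.
  by move=> v; rewrite addbb /degree big_set0.
case/andP=> /adjacent_incidence[e [Fe _ inc_e]] /IHp/[apply]-[P sPF oddP].
exists (symdiff [set e] P).
  apply/subsetP=> f; rewrite in_symdiff inE.
  by have [-> //|_ /(subsetP sPF)] := eqVneq f e.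
move=> v; rewrite odd_degree_symdiff oddP {1}/degree big_set1 -/(incidence e v).
by rewrite inc_e oddD !oddb addbA addbK.
Qed.

(** The identity says that one further edge between the two ends gives degree 2 on the path and 0
    elsewhere. It also covers the one-vertex path, where both indicators fall on the same vertex and
    a loop closes the cycle. *)
Lemma path_edge_set F u p : path (adjacent F) u p -> uniq (u :: p) ->
  exists P : {set edge G}, [/\ P \subset F,
    forall v, (degree P v + (v == u) + (v == last u p) = 2 * (v \in u :: p))%N
    & {in u :: p, forall v, connect (adjacent P) u v}].
Proof.
elim: p u => [|u' p IHp] u.
  move=> _ _; exists set0; split; first exact: sub0set.
    by move=> v; rewrite /degree big_set0 /= inE; case: (v == u).
  by move=> v; rewrite inE => /eqP->.
rewrite [path _ _ _]/= [uniq _]/= => /andP[/adjacent_incidence[e [Fe uu'_e inc_e]] pth].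
case/andP=> nu uq; have [P [sPF degP conP]] := IHp u' pth uq.
(* The edge [e] meets [u], but [u] is off the rest of the path and so has degree 0 in [P]. *)
have nPe : e \notin P.
  apply/negP=> Pe; have := degree_end (v := u) Pe.
  rewrite inc_e eqxx => /(_ isT); have := degP u; rewrite (negPf nu); lia.
exists (e |: P); split.
- by rewrite subUset sub1set Fe.
- move=> v; rewrite degreeU1 // inc_e [last _ _]/= in_cons.
  have := degP v; have [->|_] := eqVneq v u; last first.
    by rewrite orFb => <-; lia.
  by rewrite (negPf nu); lia.
have uu' : adjacent (e |: P) u u'.
  by apply: adjacentS uu'_e; rewrite sub1set setU11.
move=> v; rewrite in_cons => /predU1P[-> // | /conP con].
apply: connect_trans (connect1 uu') _; apply: connect_sub con => x y xy.
by apply/connect1/(adjacentS _ xy)/subsetUr.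
Qed.

(** A simple path between the ends of [e] that avoids [e] is closed up by [e]. For a loop the path
    has no edges. *)
Lemma cycle_through_edge F e : connect (adjacent (F :\ e)) (ends e).1 (ends e).2 ->
  exists C : {set edge G}, [/\ is_cycle C, e \in C & C \subset e |: F].
Proof.
case/connectP=> p0 /shortenP[p pth uq _] def_w.
have [P [sPF degP conP]] := path_edge_set pth uq.
rewrite -def_w in degP; set u := (ends e).1 in degP conP *.
have nPe : e \notin P by apply/negP=> /(subsetP sPF); rewrite !inE eqxx.
have degC v : degree (e |: P) v = (2 * (v \in u :: p))%N.
  rewrite degreeU1 // -degP /incidence !(eq_sym v) -/u; lia.
have endC v f : f \in e |: P -> (0 < incidence f v)%N -> v \in u :: p.
  by move=> Cf /(degree_end Cf); rewrite degC; case: (v \in _).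
exists (e |: P); split; first 2 last.
- by apply: setUS; apply: subset_trans sPF (subsetDl _ _).
- apply/existsP; exists [set v in u :: p]; apply/and3P; split.
  + apply/forallP=> f; apply/implyP=> Cf; rewrite !in_set.
    by rewrite !(endC _ f) // /incidence eqxx // addn1.
  + have conC v : v \in u :: p -> connect (adjacent (e |: P)) u v.
      move=> /conP; apply: connect_sub => x y xy.
      by apply/connect1/(adjacentS _ xy)/subsetUr.
    apply/andP; split.
      by apply/set0Pn; exists u; rewrite inE mem_head.
    apply/forallP=> x; apply/implyP; rewrite inE => /conC ux.
    apply/forallP=> y; apply/implyP; rewrite inE => /conC; apply: connect_trans.
    by rewrite (sym_connect_sym (@adjacent_sym _)).
  + by apply/forallP=> v; apply/implyP; rewrite inE degC => ->.
- exact: setU11.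
Qed.

Lemma cycle_degree C v : is_cycle C -> degree C v = 0%N \/ degree C v = 2%N.
Proof.
case/existsP=> W /and3P[/forallP subW _ /forallP degW].
have [Wv|nWv] := boolP (v \in W); first by right; apply/eqP/(implyP (degW v)).
left; apply/eqP; rewrite sum_nat_eq0; apply/forallP=> e; apply/implyP=> Ce.
have /andP[W1 W2] := implyP (subW e) Ce.
by rewrite addn_eq0 !eqb0; apply/andP; split; apply: contraNneq nWv => <-.
Qed.

(** * The boundary map and the cycle space in characteristic 2 *)

Section Boundary.
Variable K : fieldType.

(** Incidences carry no sign; only in characteristic 2, assumed below, does this agree with the
    oriented boundary. *)
Definition boundary (x : {ffun edge G -> K^o}) : {ffun vertex G -> K^o} :=
  [ffun v => \sum_e x e *+ incidence e v].

Fact boundary_is_linear : linear boundary.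
Proof.
move=> a x y; apply/ffunP=> v; rewrite !ffunE scaler_sumr -big_split /=.
by apply: eq_bigr => e _; rewrite !ffunE mulrnDl scalerMnr.
Qed.

HB.instance Definition _ := GRing.isLinear.Build K _ _ _ boundary boundary_is_linear.

Lemma boundary_chi F v : boundary (chi K F) v = (degree F v)%:R.
Proof.
rewrite ffunE degreeE natr_sum; apply: eq_bigr => e _.
by rewrite ffunE -mulrnA.
Qed.

Hypothesis K2 : 2%N \in [pchar K].

Lemma natr_odd n : n%:R = (odd n)%:R :> K.
Proof. by rewrite -(GRing.natr_mod_pchar K2) modn2. Qed.

Lemma boundary_cycle C : is_cycle C -> boundary (chi K C) = 0.
Proof.
move=> cycC; apply/ffunP=> v; rewrite boundary_chi natr_odd ffunE.
by case: (cycle_degree v cycC) => ->.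
Qed.

Lemma cycle_in_support (x : {ffun edge G -> K^o}) e :
  boundary x = 0 -> x e != 0 ->
  exists C : {set edge G}, [/\ is_cycle C, e \in C & {in C, forall f, x f != 0}].
Proof.
move=> dx0 xe; set F := [set f | x f != 0].
have Fe : e \in F by rewrite inE.
suff /cycle_through_edge[C [cycC Ce sCF]] :
    connect (adjacent (F :\ e)) (ends e).1 (ends e).2.
  exists C; split=> // f /(subsetP sCF).
  by rewrite in_setU1 inE => /predU1P[->|].
apply: contraNT xe => ncon.
pose S := [set v | connect (adjacent (F :\ e)) (ends e).1 v].
(* The edges of F other than e do not leave S, so summing the boundary over S
   isolates x e. *)
have sumS f : (\sum_(v in S) incidence f v
             = ((ends f).1 \in S) + ((ends f).2 \in S))%N.
  have sum1 w : (\sum_(v in S) (w == v) = (w \in S))%N.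
    have [Sw|nSw] := boolP (w \in S).
      rewrite (big_setD1 w) //= eqxx big1 // => v; rewrite !inE eq_sym.
      by case/andP=> /negPf->.
    by rewrite big1 // => v Sv; case: eqP nSw => // ->; rewrite Sv.
  by rewrite big_split /= !sum1.
have : \sum_(v in S) boundary x v = 0.
  by rewrite dx0 big1 // => v _; rewrite ffunE.
under eq_bigr do rewrite ffunE.
rewrite exchange_big /= (bigD1 e) //= sumrMnr sumS.
have S1 : (ends e).1 \in S by rewrite inE connect0.
have nS2 : (ends e).2 \notin S by rewrite inE.
rewrite S1 (negPf nS2) mulr1n big1 ?addr0 => [-> //|f ne_fe].
rewrite sumrMnr sumS; have [->|xf] := eqVneq (x f) 0; first by rewrite mul0rn.
have /adjacent_ends/connect1 fS : f \in F :\ e by rewrite !inE ne_fe.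
(* The set [S] is a component of [F :\ e], so [f] has both ends in it or none; with both ends
   inside, [x f] is counted twice and vanishes. *)
have -> : ((ends f).2 \in S) = ((ends f).1 \in S).
  rewrite !inE; apply/idP/idP => /connect_trans; last exact.
  by apply; rewrite (sym_connect_sym (@adjacent_sym _)).
by case: (_ \in S); rewrite ?mulr0n // (mulrS _ 1) mulr1n addrr_pchar2.
Qed.

Lemma cycle_space_ker : cycle_space G K = lker (linfun boundary).
Proof.
apply/eqP; rewrite eqEsubv; apply/andP; split.
  apply/span_subvP=> _ /mapP[C + ->]; rewrite mem_enum => cycC.
  by rewrite memv_ker lfunE /= boundary_cycle.
apply/subvP=> x; rewrite memv_ker lfunE /= => /eqP.
have [n] := ubnP #|[set e | x e != 0]|; elim: n x => // n IHn x lt_x dx0.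
have [/forallP x0|/existsP[e xe]] := boolP [forall e, x e == 0].
  suff -> : x = 0 by rewrite mem0v.
  by apply/ffunP=> e; rewrite ffunE; apply/eqP.
have [C [cycC Ce sC]] := cycle_in_support dx0 xe.
(* The coefficient [x e] kills the entry at [e], and [C] lies in the support, so the support shrinks
   strictly. *)
rewrite -(subrK (x e *: (chi K C : {ffun edge G -> K^o})) x) rpredD //; last first.
  by apply/rpredZ/memv_span/map_f; rewrite mem_enum.
apply: IHn; last first.
  by rewrite linearB linearZ /= dx0 boundary_cycle // scaler0 subr0.
rewrite ltnS in lt_x; apply: leq_trans lt_x; rewrite [ltnRHS](cardsD1 e) inE xe add1n ltnS.
apply/subset_leq_card/subsetP=> f; rewrite !inE !ffunE.
have [->|_] := eqVneq f e; first by rewrite Ce [_ *: _]mulr1 subrr eqxx.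
apply: contraNneq => xf; rewrite xf.
by case: (boolP (f \in C)) => [/sC|_]; rewrite ?xf ?eqxx // scaler0 subr0.
Qed.

(** Rank-nullity is applied twice: to [boundary], whose kernel is the cycle space, and to [total],
    which is onto [K] and whose kernel is the image of [boundary]. *)
Lemma dim_cycle_space_pchar2 : is_connected [set: vertex G] [set: edge G] ->
  (\dim (cycle_space G K) + #|vertex G| = #|edge G| + 1)%N.
Proof.
case/andP=> /set0Pn[v0 _] /forallP con.
have {}con u v : connect (adjacent [set: edge G]) u v.
  by move/implyP: (con u) => /(_ (in_setT _))/forallP/(_ v)/implyP; apply.
pose total (y : {ffun vertex G -> K^o}) : K^o := \sum_v y v.
have total_lin : linear total.
  move=> a x y; rewrite /total scaler_sumr -big_split.
  by apply: eq_bigr => v _; rewrite !ffunE.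
pose total_mixin := GRing.isLinear.Build K _ _ _ total total_lin.
pose totalL : {linear _ -> _} := HB.pack total total_mixin.
pose delta v : {ffun vertex G -> K^o} := [ffun w => (w == v)%:R].
have limgE : limg (linfun boundary) = lker (linfun totalL).
  apply/eqP; rewrite eqEsubv; apply/andP; split; apply/subvP=> y.
    case/memv_imgP=> x _ ->; rewrite memv_ker !lfunE /= /total.
    under eq_bigr do rewrite ffunE.
    rewrite exchange_big big1 //= => e _; rewrite sumrMnr big_split /=.
    have sum1 w : (\sum_v (w == v) = 1)%N.
      by rewrite (bigD1 w) //= eqxx big1 // => v; rewrite eq_sym => /negPf->.
    by rewrite !sum1 (mulrS _ 1) mulr1n addrr_pchar2.
  rewrite memv_ker lfunE /= /total => /eqP y0.
  (* The added multiples of [delta v0] sum to zero with the coordinates of [y]. Each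
     [delta v + delta v0] is the boundary of an edge set joining [v] to [v0]. *)
  have -> : y = \sum_v y v *: (delta v + delta v0).
    apply/ffunP=> w; rewrite sum_ffunE.
    under eq_bigr => v do rewrite !ffunE [_ *: _]mulrDr.
    rewrite big_split /= -mulr_suml y0 mul0r addr0.
    rewrite (bigD1 w) //= eqxx mulr1 big1 ?addr0 // => v.
    by rewrite eq_sym => /negPf->; rewrite mulr0.
  apply: rpred_sum => v _; apply: rpredZ.
  have [P _ oddP] := connected_odd_set (con v v0).
  apply/memv_imgP; exists (chi K P); first exact: memvf.
  apply/ffunP=> w; rewrite lfunE /= boundary_chi natr_odd oddP !ffunE.
  case: (w == v); case: (w == v0); rewrite ?addr0 ?add0r //.
  by rewrite addrr_pchar2.
have dim_total : \dim (limg (linfun totalL)) = 1%N.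
  suff -> : limg (linfun totalL) = fullv by rewrite dimvf.
  apply/eqP; rewrite eqEsubv subvf; apply/subvP=> a _.
  apply/memv_imgP; exists (a *: delta v0); first exact: memvf.
  rewrite lfunE /= /total (bigD1 v0) //= !ffunE eqxx [_ *: _]mulr1.
  by rewrite big1 ?addr0 // => v /negPf nv; rewrite !ffunE nv [_ *: _]mulr0.
have := limg_ker_dim (linfun boundary) fullv.
have := limg_ker_dim (linfun totalL) fullv.
rewrite !capfv -cycle_space_ker dim_total limgE !dimvf.
have -> : dim {ffun vertex G -> K^o} = #|vertex G| by exact: muln1.
have -> : dim {ffun edge G -> K^o} = #|edge G| by exact: muln1.
by move=> <- <-; rewrite addnA.
Qed.

End Boundary.

End Graph.

(** * Closure properties of integer spans *)

Section IntSpan.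
Variables (V : zmodType) (m : nat) (s : m.-tuple V).

Lemma inIntSpan_mem v : v \in s -> inIntSpan s v.
Proof.
case/tnthP=> i ->; exists [ffun j => Posz (j == i)].
rewrite (bigD1 i) //= ffunE eqxx big1 ?addr0 => [|j /negPf nji].
  by rewrite mulr1z (tnth_nth 0).
by rewrite ffunE nji mulr0z.
Qed.

Lemma inIntSpan0 : inIntSpan s 0.
Proof. by exists 0; rewrite big1 // => i _; rewrite ffunE mulr0z. Qed.

Lemma inIntSpanB x y : inIntSpan s x -> inIntSpan s y -> inIntSpan s (x - y).
Proof.
move=> [a ->] [b ->]; exists (a - b).
by rewrite -sumrB; apply: eq_bigr => i _; rewrite !ffunE mulrzBr.
Qed.

Lemma inIntSpanD x y : inIntSpan s x -> inIntSpan s y -> inIntSpan s (x + y).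
Proof.
move=> sx sy; rewrite -[y]opprK -[- y]sub0r.
exact/inIntSpanB/inIntSpanB/sy/inIntSpan0.
Qed.

End IntSpan.

(** * Even edge sets and multiples of single edges in the cycle lattice *)

Section Lattice.
Variable G : multigraph.
Implicit Types (F C P I : {set edge G}) (e f : edge G).

Definition even_set F : bool := [forall v, ~~ odd (degree F v)].

Lemma even_setP F : reflect (forall v, odd (degree F v) = false) (even_set F).
Proof.
by apply: (iffP forallP) => evF v; have := evF v; [move/negPf | move->].
Qed.

Lemma even_symdiff F P : even_set F -> even_set P -> even_set (symdiff F P).
Proof.
move=> /even_setP evF /even_setP evP; apply/even_setP=> v.
by rewrite odd_degree_symdiff evF evP.
Qed.

Lemma even_cycle C : is_cycle C -> even_set C.
Proof.
by move=> cycC; apply/even_setP=> v; case: (cycle_degree v cycC) => ->.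
Qed.

(** Over the field with two elements an even set has boundary zero, so a nonempty one contains a
    cycle. Removing that cycle leaves a smaller even set. *)
Lemma even_set_lattice F : even_set F -> cycle_lattice (chi int F).
Proof.
have [n] := ubnP #|F|; elim: n F => // n IHn F; rewrite ltnS => leFn evF.
have [->|/set0Pn[e Fe]] := eqVneq F set0.
  suff -> : chi int (set0 : {set edge G}) = 0 by apply: inIntSpan0.
  by apply/ffunP=> f; rewrite !ffunE inE.
have F2 : 2%N \in [pchar 'F_2] by rewrite pchar_Fp.
have dF : boundary (chi 'F_2 F) = 0.
  apply/ffunP=> v; rewrite boundary_chi (natr_odd F2) ffunE.
  by rewrite (even_setP F evF).
have [|C [cycC Ce sCF]] := cycle_in_support F2 dF (e := e).
  by rewrite ffunE Fe.
have {}sCF f : f \in C -> f \in F by move/sCF; rewrite ffunE; case: (f \in F).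
have -> : chi int F = chi int C + chi int (symdiff F C).
  apply/ffunP=> f; rewrite !ffunE in_symdiff.
  by have := sCF f; case: (f \in C); case: (f \in F) => // /(_ isT).
apply: inIntSpanD.
  by apply: inIntSpan_mem; apply: map_f; rewrite mem_enum.
apply: IHn; last exact/even_symdiff/even_cycle.
apply: leq_trans leFn; apply/proper_card/properP; split.
  apply/subsetP=> f; rewrite in_symdiff; have := sCF f.
  by case: (f \in C) => [->|_]; rewrite ?addbF.
by exists e => //; rewrite in_symdiff Fe Ce.
Qed.

(* 2 (1_(F n A n I)) = 1_(F n I) + 1_(A n I) - 1_((F + A) n I), where F + A is
   again even: each further even set costs one factor 2. *)
Lemma even_sets_inter_lattice F (s : seq {set edge G}) :
  even_set F -> all even_set s ->
  cycle_lattice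
    (chi int [set e in F | all (fun A : {set edge G} => e \in A) s]
       *+ 2 ^ size s).
Proof.
elim: s F => [|A s IHs] F evF /=.
  move=> _; have -> : [set e in F | true] = F by apply/setP=> e; rewrite inE andbT.
  by rewrite mulr1n; apply: even_set_lattice.
case/andP=> evA evs.
set I := [set e in F | _].
have -> : chi int I *+ 2 ^ (size s).+1 =
    chi int [set e in F | all (fun A : {set edge G} => e \in A) s] *+ 2 ^ size s
  + chi int [set e in A | all (fun A : {set edge G} => e \in A) s] *+ 2 ^ size s
  - chi int [set e in symdiff F A | all (fun A : {set edge G} => e \in A) s]
      *+ 2 ^ size s.
  rewrite expnS mulrnA -mulrnDl -mulrnBl; congr (_ *+ _).
  apply/ffunP=> e; rewrite mulr2n !ffunE !inE.
  by case: (e \in F); case: (e \in A); case: (all _ s).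
by apply: inIntSpanB; first apply: inIntSpanD; apply: IHs => //; apply: even_symdiff.
Qed.

Hypothesis hG : three_edge_connected G.

Lemma three_edge_connected_del F u v : (#|F| <= 2)%N ->
  connect (adjacent (~: F)) u v.
Proof.
move=> leF2; have /forallP/(_ F) := hG; rewrite leF2 => /andP[_ /forallP].
by move=> /(_ u)/implyP/(_ (in_setT _))/forallP/(_ v)/implyP; apply; apply: in_setT.
Qed.

(** The ends of [e] stay connected after deleting both [e] and [f]; a set with odd degrees exactly
    at these ends, completed by [e], is even and misses [f]. *)
Lemma even_set_separating e f :
  exists A : {set edge G}, [/\ even_set A, e \in A & f != e -> f \notin A].
Proof.
have [|P /subsetP sP oddP] := connected_odd_set
    (three_edge_connected_del (F := [set e; f]) (ends e).1 (ends e).2 _).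
  by rewrite cards2; case: (_ != _).
have nPe : e \notin P by apply/negP=> /sP; rewrite !inE eqxx.
have nPf : f \notin P by apply/negP=> /sP; rewrite !inE eqxx orbT.
exists (symdiff [set e] P); split.
- apply/even_setP=> v; rewrite odd_degree_symdiff oddP.
  by rewrite /degree big_set1 oddD !oddb !(eq_sym v) addbb.
- by rewrite in_symdiff set11 (negPf nPe).
- by rewrite in_symdiff inE (negPf nPf) => /negPf->.
Qed.

Lemma edge_multiple_lattice e :
  cycle_lattice (chi int [set e] *+ 2 ^ #|{set edge G}|).
Proof.
have [F [evF Fe _]] := even_set_separating e e.
(* The intersection runs over all even sets containing [e]. Unsuitable sets are replaced by [F]
   rather than dropped, so the exponent is the same for every edge. *)
pose pad A := if even_set A && (e \in A) then A else F.
pose s := map pad (enum {set edge G}).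
have szs : size s = #|{set edge G}| by rewrite size_map -cardE.
have evs : all even_set s.
  by apply/allP=> _ /mapP[A _ ->]; rewrite /pad; case: andP => [[]|].
have := even_sets_inter_lattice evF evs; rewrite szs.
congr (cycle_lattice (chi int _ *+ _)); apply/setP=> f; rewrite !inE.
apply/andP/eqP=> [[_ /allP sf]|->]; last first.
  split=> //; apply/allP=> _ /mapP[A _ ->]; rewrite /pad.
  by case: andP => [[]|].
apply: contraTeq isT => ne_fe.
have [A [evA Ae /(_ ne_fe)/negP[]]] := even_set_separating e f.
by apply: sf; apply/mapP; exists A; rewrite ?mem_enum // /pad evA Ae.
Qed.

End Lattice.

(** * Reduction to a field of characteristic other than 2 *)

Section Reduce.
Variables (G : multigraph) (K : fieldType).
Implicit Types (x y : {ffun edge G -> int}) (e : edge G).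

Fact reduce_is_zmod_morphism : zmod_morphism (@reduce G K).
Proof. by move=> x y; apply/ffunP=> e; rewrite !ffunE rmorphB. Qed.

HB.instance Definition _ :=
  GRing.isZmodMorphism.Build _ _ (@reduce G K) reduce_is_zmod_morphism.

Lemma sum_chi1 x : x = \sum_e chi int [set e] *~ x e.
Proof.
apply/ffunP=> f; rewrite sum_ffunE (bigD1 f) //= big1 ?addr0 => [|e ne_ef].
  by case: (x f) => n; rewrite ?ffunE ffunMnE ffunE set11 -mulr_natr mul1r // natz.
by case: (x e) => n; rewrite ?ffunE ffunMnE ffunE inE eq_sym (negPf ne_ef) mul0rn.
Qed.

Lemma reduceMz x n : reduce K (x *~ n) = n%:~R *: reduce K x.
Proof. by rewrite raddfMz scaler_int. Qed.

Lemma reduce_chi (C : {set edge G}) : reduce K (chi int C) = chi K C.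
Proof. by apply/ffunP=> e; rewrite !ffunE; case: (e \in C). Qed.

Lemma reduce_inIntSpan m (s : m.-tuple {ffun edge G -> int}) x :
  inIntSpan s x -> reduce K x \in <<[seq reduce K y | y <- s]>>%VS.
Proof.
case=> a ->; rewrite raddf_sum; apply: rpred_sum => i _.
rewrite /= reduceMz; apply/rpredZ/memv_span/map_f.
by rewrite mem_nth ?size_tuple.
Qed.

Lemma reduce_cycle_vectors :
  [seq reduce K x | x <- cycle_vectors G int] = cycle_vectors G K.
Proof. by rewrite -map_comp; apply: eq_map => C; apply: reduce_chi. Qed.

(** A power of 2 times each unit vector reduces into the cycle space, and this power is invertible
    in [K]. *)
Lemma cycle_space_full : three_edge_connected G -> 2%N \notin [pchar K] ->
  cycle_space G K = fullv.
Proof.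
move=> hG K2; apply/eqP; rewrite eqEsubv subvf; apply/subvP=> x _.
have -> : x = \sum_e x e *: (chi K [set e] : {ffun edge G -> K^o}).
  apply/ffunP=> f; rewrite sum_ffunE (bigD1 f) //= !ffunE set11 [_ *: _]mulr1.
  rewrite big1 ?addr0 // => e ne_ef.
  by rewrite !ffunE inE eq_sym (negPf ne_ef) [_ *: _]mulr0.
apply: rpred_sum => e _; apply: rpredZ.
have := reduce_inIntSpan (edge_multiple_lattice hG e).
rewrite /= reduce_cycle_vectors raddfMn /= reduce_chi -scaler_nat rpredZeq.
by rewrite natrX expf_eq0; move: K2; rewrite inE /= => /negPf->; rewrite andbF.
Qed.

Lemma reduce_Zbasis (b : seq {ffun edge G -> int}) :
  three_edge_connected G -> 2%N \notin [pchar K] ->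
  is_Zbasis (@cycle_lattice G) b ->
  basis_of (cycle_space G K) [seq reduce K x | x <- b].
Proof.
move=> hG K2 [spanb freeb].
have cycle_sub : (cycle_space G K <= <<[seq reduce K x | x <- b]>>)%VS.
  rewrite /cycle_space -reduce_cycle_vectors; apply/span_subvP=> _ /mapP[x Lx ->].
  exact/(reduce_inIntSpan (s := in_tuple b))/spanb/inIntSpan_mem.
rewrite basisEfree; apply/and3P; split; last 2 first.
- by rewrite cycle_space_full // subvf.
- exact: leq_trans (dimvS cycle_sub) (dim_span _).
pose N := (2 ^ #|{set edge G}|)%N.
(* Row [e] of [A] holds the coordinates of [N] times the unit vector of [e] in the basis [b]. *)
have [A NA] : exists A : edge G -> int ^ size b,
    forall e, chi int [set e] *+ N = \sum_(i < size b) b`_i *~ A e i.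
  suff /fin_all_exists : forall e, exists a : int ^ size b,
    chi int [set e] *+ N = \sum_(i < size b) b`_i *~ a i by [].
  by move=> e; apply/spanb/edge_multiple_lattice.
(* Expanding [N] times [b_j] over the edges and then through [A] writes it again as a combination of
   [b]; independence over the integers identifies the coefficients. *)
have BA i (j : 'I_(size b)) : \sum_e b`_j e * A e i = (N * (i == j))%:Z.
  pose c k := \sum_e b`_j e * A e k - (N * (k == j))%:Z.
  suff /freeb/(_ i)/eqP : \sum_(i < size b) b`_i *~ c i = 0.
    by rewrite subr_eq0 => /eqP.
  under eq_bigr do rewrite mulrzBr; rewrite sumrB.
  rewrite [X in _ - X](bigD1 j) //= eqxx muln1 [X in _ - (_ + X)]big1 ?addr0.
    have -> : b`_j *~ N = \sum_e (chi int [set e] *+ N) *~ b`_j e.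
      rewrite {1}(sum_chi1 b`_j) mulrz_suml; apply: eq_bigr => e _.
      by rewrite mulrzAC -pmulrn.
    apply/eqP; rewrite subr_eq0; apply/eqP.
    under [RHS]eq_bigr do rewrite NA mulrz_suml.
    rewrite exchange_big /=; apply: eq_bigr => k _.
    rewrite mulrz_sumr; apply: eq_bigr => e _.
    by rewrite -mulrzA mulrC.
  by move=> k /negPf->; rewrite muln0 mulr0z.
apply/(@freeP _ _ _ (map_tuple (reduce K) (in_tuple b))) => c c0 i.
have {}c0 e : \sum_(j < size b) c j * (b`_j e)%:~R = 0.
  have /ffunP/(_ e) := c0; rewrite sum_ffunE ffunE => {2}<-.
  by apply: eq_bigr => j _; rewrite !ffunE (nth_map 0) // ffunE.
(* Multiplying the relation [c B = 0] by column [i] of [A] leaves [N] times [c i], where [N] is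
   nonzero in [K]. *)
have : \sum_(j < size b) c j * (\sum_e b`_j e * A e i)%:~R = 0.
  under eq_bigr do rewrite rmorph_sum mulr_sumr.
  rewrite exchange_big /= big1 // => e _.
  under eq_bigr do rewrite rmorphM mulrA.
  by rewrite -mulr_suml c0 mul0r.
under eq_bigr do rewrite BA.
rewrite (bigD1 i) //= eqxx muln1 big1 ?addr0 => [/eqP|j].
  rewrite mulf_eq0 -pmulrn natrX expf_eq0.
  by move: K2; rewrite inE /= => /negPf->; rewrite andbF orbF => /eqP.
by rewrite eq_sym => /negPf->; rewrite muln0 mulr0.
Qed.


End Reduce.

(** * From the binary cycle space to a field of characteristic 2 *)

Section BinaryInclusion.
Variables (G : multigraph) (K : fieldType).
Hypothesis K2 : 2%N \in [pchar K].

Let incl (a : 'F_2) : K := (nat_of_ord a)%:R.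

Lemma binary_incl_chi (C : {set edge G}) : binary_incl K (chi 'F_2 C) = chi K C.
Proof. by apply/ffunP=> e; rewrite !ffunE; case: (e \in C). Qed.

(** The scalar fields differ, so the inclusion is only semilinear. Reduction modulo 2 of the
    representatives is invisible in [K]. *)
Lemma binary_incl_lin a (x y : {ffun edge G -> ('F_2)^o}) :
  binary_incl K (a *: x + y) = incl a *: binary_incl K x + binary_incl K y.
Proof.
apply/ffunP=> e; rewrite !ffunE.
transitivity ((nat_of_ord a * nat_of_ord (x e) + nat_of_ord (y e))%N%:R : K).
  by rewrite -[RHS](GRing.natr_mod_pchar K2) -modnDml; congr _%:R.
by rewrite natrD natrM.
Qed.

Lemma binary_incl_span (s : seq {ffun edge G -> ('F_2)^o}) x :
  x \in <<s>>%VS -> binary_incl K x \in <<[seq binary_incl K y | y <- s]>>%VS.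
Proof.
move=> /(coord_span (X := in_tuple s))->; set c := coord _.
have s_i (i : 'I_(size s)) : s`_i \in s by rewrite mem_nth.
elim/big_rec: _ => [|i y _ IHy].
  suff -> : binary_incl K (0 : {ffun edge G -> ('F_2)^o}) = 0 by rewrite mem0v.
  by apply/ffunP=> e; rewrite !ffunE.
by rewrite binary_incl_lin rpredD // rpredZ // memv_span // map_f.
Qed.

(** Independence comes from counting: the images span, since they generate all cycle vectors, and
    the dimension formula gives the same value over both fields. *)
Lemma binary_incl_basis (b : seq {ffun edge G -> ('F_2)^o}) :
  is_connected [set: vertex G] [set: edge G] ->
  basis_of (binary_cycle_space G) b ->
  basis_of (cycle_space G K) [seq binary_incl K x | x <- b].
Proof.
move=> conG basis_b; rewrite basisEdim; apply/andP; split.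
  apply/span_subvP=> _ /mapP[C cycC ->]; rewrite -binary_incl_chi.
  by apply: binary_incl_span; rewrite (span_basis basis_b) memv_span ?map_f.
rewrite size_map -(size_basis (X := in_tuple b) basis_b).
have F2 : 2%N \in [pchar 'F_2] by rewrite pchar_Fp.
by rewrite -(leq_add2r #|vertex G|) !dim_cycle_space_pchar2.
Qed.

End BinaryInclusion.

Unset Implicit Arguments.

Theorem theorem1p7 (G : multigraph) (m n : nat) (K : fieldType) (p : nat)
    (hG : three_edge_connected G)
    (hm : #|edge G| = m) (hn : #|vertex G| = n)
    (hp : has_characteristic K p) :
  [/\ (\dim (cycle_space G K))%:Z =
        (if p == 2%N then m%:Z - n%:Z + 1 else m%:Z),
      p <> 2%N ->
        forall b : seq {ffun edge G -> int},
          is_Zbasis (@cycle_lattice G) b ->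
          basis_of (cycle_space G K) [seq reduce K x | x <- b]
    & p = 2%N ->
        forall b : seq {ffun edge G -> ('F_2)^o},
          basis_of (binary_cycle_space G) b ->
          basis_of (cycle_space G K) [seq binary_incl K x | x <- b]].
Proof.
have conG : is_connected [set: vertex G] [set: edge G].
  by have /forallP/(_ set0) := hG; rewrite cards0 setC0.
(* For [p = 0] the set of characteristics is empty; otherwise [p] is its only element. *)
have K2 : (2%N \in [pchar K]) = (p == 2%N).
  case: p hp => [/(_ 2%N) // | p Kp].
  by rewrite (GRing.pcharf_eq Kp) inE eq_sym.
split; last first.
- by move=> p2 b; apply: binary_incl_basis; rewrite // K2 p2.
- by move=> /eqP p2 b; apply: reduce_Zbasis; rewrite // K2.
have [p2|p2] := ifPn.
  have := dim_cycle_space_pchar2 (etrans K2 p2) conG; rewrite hm hn => dimE.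
  by apply/eqP; rewrite addrAC eq_sym subr_eq -!PoszD dimE.
rewrite cycle_space_full ?K2 // dimvf -hm; congr Posz; exact: muln1.
Qed.
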